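(* Let $m$ be a positive integer and $a/b$ an irreducible fraction ($a\in\mathbb{Z}$, $b$ a positive integer, $\gcd(a,b)=1$). Let $b'=b$ if $b$ is odd and $b'=b/2$ if $b$ is even, and let $x_0,\alpha,c,r_i,P_i$ be as defined in the context. Then the quadratic residues modulo $m$ of integers near $(a/b)m$ split as integer points of $b'$ parabolas (that is, $b$ parabolas if $b$ is odd, $b/2$ parabolas if $b$ is even), with their vertices placed at $x_v=(a/b)m$ and equidistant in between. Precisely, let $i$ run over a set of $b'$ integers with $|i|\le b'/2$ that are pairwise incongruent modulo $b'$. Then: (1) for each such $i$ and every integer $j$, the integer $x=x_0+i+jb'$ satisfies $x^2\equiv P_i(j)\pmod m$; (2) for each such $i$, the vertex of the parabola $P_i$ (the point $j=j_v\in\mathbb{Q}$ where $P_i'(j_v)=0$) has abscissa $x_v=x_0+i+j_vb'=\frac{a}{b}m$, independent of $i$; (3) the $b'$ vertex ordinates $P_i(j_v)$ are equidistant modulo $m$: regarded in $\mathbb{R}/m\mathbb{Z}$, they are pairwise distinct and form the set $\{y+k\frac{m}{b'} : k=0,1,\dots,b'-1\}$ for some $y$, so that consecutive ones are separated by gaps of exactly $m/b'$.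
   Context: Let $x_0=\lfloor \frac{a}{b}m+\frac12\rfloor$ (the nearest integer to $\frac{a}{b}m$) and $\alpha=am-bx_0$, so $\alpha\equiv am\pmod b$ and $|\alpha|\le b/2$. Let $c=b/b'$, so $c=1$ if $b$ is odd and $c=2$ if $b$ is even. For an integer $i$, let $r_i\in\{0,\dots,m-1\}$ be the quadratic residue of $x_0+i$ modulo $m$, i.e. $r_i\equiv (x_0+i)^2\pmod m$. The parabola $P_i$ is the quadratic polynomial in the variable $j$ $$P_i(j)={b'}^2j^2+2\left(b'i-\frac{\alpha}{c}\right)j+r_i .$$ It is plotted as a curve in the $(x,y)$-plane via $x=x_0+i+jb'$, $y=P_i(j)$, the ordinate being considered modulo $m$. Two rationals $s,t$ are called congruent modulo $m$ when $(s-t)/m$ is an integer. *)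

(* Defs.v *)
From HB Require Import structures.
From mathcomp Require Import all_boot all_order all_algebra.
From mathcomp Require Import finmap.

Set Implicit Arguments.
Unset Strict Implicit.
Unset Printing Implicit Defensive.

Import Order.TTheory GRing.Theory Num.Theory.
Local Open Scope ring_scope.

(* Rational arguments are allowed: vertex ordinates are not integers. *)
Definition cong_mod (m : nat) (s t : rat) : Prop :=
  (s - t) / m%:R \is a Num.int.

Definition bprime (b : nat) : nat := if odd b then b else b./2.

Definition x0 (m : nat) (a : int) (b : nat) : int :=
  Num.floor (a%:~R / b%:R * m%:R + 1 / 2 : rat).

Definition alpha (m : nat) (a : int) (b : nat) : int :=
  a * m%:Z - b%:Z * x0 m a b.

Definition cfactor (b : nat) : rat := b%:R / (bprime b)%:R.

Definition residue (m : nat) (a : int) (b : nat) (i : int) : int :=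
  (((x0 m a b + i) ^+ 2) %% m%:Z)%Z.

(* alpha / c may be a half-integer when b is even, so P_i is taken over
   the rationals. *)
Definition parabola (m : nat) (a : int) (b : nat) (i : int) : {poly rat} :=
  (bprime b)%:R ^+ 2 *: 'X^2
  + (2 * ((bprime b)%:R * i%:~R - (alpha m a b)%:~R / cfactor b)) *: 'X
  + ((residue m a b i)%:~R)%:P.

(* Main.v *)
(** Put u = 2a if b is odd and u = a if b is even, so that u is an integer
    coprime to b' and u / b' = 2a / b.  Completing the square gives
    P_i(t) = (x0 + i + t b')^2 - u m t modulo m, which yields (1) for integer t,
    and shows that the vertex has abscissa (a/b) m and ordinate
    y + u i (m / b') modulo m, with y independent of i.  As i runs over a
    complete residue system modulo b', so does u i. *)
Require Import Defs.
From HB Require Import structures.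
From mathcomp Require Import all_boot all_order all_algebra.
From mathcomp Require Import finmap.
From mathcomp Require Import zify ring lra.

Set Implicit Arguments.
Unset Strict Implicit.
Unset Printing Implicit Defensive.

Import Order.TTheory GRing.Theory Num.Theory.
Local Open Scope ring_scope.

Lemma bprime_gt0 (b : nat) : (0 < b)%N -> (0 < bprime b)%N.
Proof. by rewrite /bprime; case: ifP; lia. Qed.

Definition slope (a : int) (b : nat) : int := if odd b then 2 * a else a.

Lemma slopeE (a : int) (b : nat) : slope a b * b%:Z = 2 * a * (bprime b)%:Z.
Proof.
rewrite /slope /bprime; case: ifP => // b_even.
have -> : b%:Z = 2 * b./2%:Z by lia.
by rewrite mulrCA mulrA.
Qed.

Lemma slope_coprime (a : int) (b : nat) :
  coprimez a b%:Z -> coprimez (slope a b) (bprime b)%:Z.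
Proof.
rewrite /slope /bprime; case: ifP => [b_odd|b_even] ab.
  by rewrite coprimezMl ab andbT coprimezE /= coprime2n.
apply: (coprimez_dvdr _ ab); apply/dvdnP; exists 2%N; lia.
Qed.

Lemma dvdz_div_int (n : nat) (k : int) : (0 < n)%N ->
  ((k%:~R / n%:R : rat) \is a Num.int) = (n%:Z %| k)%Z.
Proof.
move=> n_gt0; have n0 : n%:R != 0 :> rat by rewrite pnatr_eq0 -lt0n.
apply/intrP/dvdzP => -[q Eq]; exists q.
  apply/eqP; rewrite -(eqr_int rat) intrM -Eq.
  by rewrite -[n%:Z%:~R]/(n%:R : rat) divfK.
by rewrite Eq intrM -[n%:Z%:~R]/(n%:R : rat) mulfK.
Qed.

(** Multiplication by [u] is injective modulo [n], so [i |-> u * i %% n] is an injection from [I]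
    into ['I_n]. Both sets have [n] elements, so it is onto and hits the class of [k]. *)
Lemma scaled_residue_system (n : nat) (u : int) (I : {fset int}) (k : int) :
  (0 < n)%N -> coprimez u n%:Z -> #|` I|%fset = n ->
  (forall i i' : int, i \in I -> i' \in I -> i <> i' ->
     (i <> i' %[mod n%:Z])%Z) ->
  exists2 i : int, i \in I & (n%:Z %| u * i - k)%Z.
Proof.
move=> n_gt0 un cardI incongr.
have n0 : n%:Z != 0 by lia.
have lt_mod (x : int) : (`|(x %% n%:Z)%Z| < n)%N.
  by have := modz_ge0 x n0; have := ltz_pmod x (_ : 0 < n%:Z); lia.
pose f (i : I) : 'I_n := Ordinal (lt_mod (u * val i)).
have f_inj : injective f.
  move=> i i' [/eqP]; rewrite -eqz_nat !gez0_abs ?modz_ge0 // => e.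
  apply/val_inj/eqP/negPn/negP => /eqP ne.
  apply: (incongr _ _ (valP i) (valP i') ne); apply/eqP.
  rewrite eqz_mod_dvd; move: e; rewrite eqz_mod_dvd -mulrBr.
  by rewrite Gauss_dvdzr // coprimez_sym.
have /(inj_card_onto f_inj) /(_ (Ordinal (lt_mod k))) : (#|'I_n| <= #|{: I}|)%N.
  by rewrite card_ord -cardfE cardI.
case/codomP => i [/eqP]; rewrite -eqz_nat !gez0_abs ?modz_ge0 // eq_sym => e.
by exists (val i); [exact: valP | rewrite -eqz_mod_dvd].
Qed.

Section Parabola.

Variables (m : nat) (a : int) (b : nat).
Hypothesis b_gt0 : (0 < b)%N.

Let B : rat := (bprime b)%:R.
Let X : rat := (x0 m a b)%:~R.
Let u : rat := (slope a b)%:~R.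
Let xv : rat := a%:~R / b%:R * m%:R.

Let B0 : B != 0. Proof. by rewrite pnatr_eq0 -lt0n bprime_gt0. Qed.
Let b0 : (b%:R : rat) != 0. Proof. by rewrite pnatr_eq0 -lt0n. Qed.

Lemma slope_vertex : u * m%:R = 2 * B * xv.
Proof.
have E : u * b%:R = 2 * a%:~R * B.
  by have := congr1 (intr : int -> rat) (slopeE a b); rewrite !intrM.
apply: (mulIf b0); rewrite mulrAC E /xv; field; exact: b0.
Qed.

(** Since [c = b / b'], the term [alpha / c] equals [B * (xv - X)], and [2 * B * xv] is [u * m] by
    [slope_vertex]. *)
Lemma linear_coefE (i : int) :
  2 * (B * i%:~R - (alpha m a b)%:~R / cfactor b)
  = 2 * B * (X + i%:~R) - u * m%:R.
Proof.
rewrite slope_vertex /xv /alpha /cfactor -/B rmorphB /= !intrM -/X.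
rewrite -[m%:Z%:~R]/(m%:R : rat) -[b%:Z%:~R]/(b%:R : rat).
by field; rewrite B0 b0.
Qed.

(** The residue is the square of [x0 + i] minus [m] times its quotient. Keeping that quotient gives
    an exact identity, which can be evaluated at integers and at the rational vertex alike. *)
Lemma parabola_square (i : int) (t : rat) :
  (parabola m a b i).[t] = (X + i%:~R + t * B) ^+ 2 - u * m%:R * t
    - m%:R * (((x0 m a b + i) ^+ 2) %/ m%:Z)%Z%:~R.
Proof.
rewrite /parabola linear_coefE -/B !hornerE /=.
set q := (_ %/ _)%Z.
have -> : (residue m a b i)%:~R = (X + i%:~R) ^+ 2 - m%:R * q%:~R :> rat.
  have -> : X + i%:~R = (x0 m a b + i)%:~R by rewrite intrD.
  rewrite -rmorphXn /= (divz_eq (_ ^+ 2) m%:Z) -/(residue m a b i) -/q.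
  move: (residue m a b i) => r.
  by rewrite intrD intrM -[m%:Z%:~R]/(m%:R : rat); ring.
by ring.
Qed.

Lemma parabola_deriv_eq0 (i : int) (t : rat) :
  ((parabola m a b i)^`()).[t] = 0 <-> t = (xv - X - i%:~R) / B.
Proof.
have -> : ((parabola m a b i)^`()).[t] = 2 * B * (X + i%:~R + t * B - xv).
  rewrite /parabola linear_coefE slope_vertex -/B !derivE !hornerE /= /xv; ring.
split=> [/eqP | ->]; last by field; exact: B0.
rewrite !mulf_eq0 (negPf B0) orbF /= => /eqP E.
by apply: (mulIf B0); rewrite divfK //; lra.
Qed.

(** At the vertex the squared term is [xv ^+ 2]. Only the last two terms depend on [i]: an integer
    number of gaps [m / B], and an integer multiple of [m]. *)
Lemma vertex_ordinate (i : int) :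
  (parabola m a b i).[(xv - X - i%:~R) / B] =
    xv ^+ 2 - u * m%:R * ((xv - X) / B) + (slope a b * i)%:~R * (m%:R / B)
    - m%:R * (((x0 m a b + i) ^+ 2) %/ m%:Z)%Z%:~R.
Proof. rewrite parabola_square intrM -/u; by field; exact: B0. Qed.

End Parabola.

(** Turns congruence of ordinates into divisibility: dividing by [m] leaves [k / n - q], where [q]
    is an integer. *)
Lemma cong_mod_gap (m n : nat) (s t : rat) (k q : int) :
  (0 < m)%N -> (0 < n)%N ->
  s - t = k%:~R * (m%:R / n%:R) - m%:R * q%:~R ->
  cong_mod m s t <-> (n%:Z %| k)%Z.
Proof.
move=> m_gt0 n_gt0 E; rewrite /cong_mod E -dvdz_div_int //.
have m0 : m%:R != 0 :> rat by rewrite pnatr_eq0 -lt0n.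
have -> : (k%:~R * (m%:R / n%:R) - m%:R * q%:~R) / m%:R
          = k%:~R / n%:R - q%:~R :> rat.
  by field; rewrite m0 pnatr_eq0 -lt0n n_gt0.
by rewrite rpredBr // intr_int.
Qed.

Theorem proposition2 (m : nat) (a : int) (b : nat) (I : {fset int})
  (m_gt0 : (0 < m)%N) (b_gt0 : (0 < b)%N) (coprime_ab : coprimez a b%:Z)
  (card_I : #|` I|%fset = bprime b)
  (I_bounded : forall i : int, i \in I ->
     `|i%:~R : rat| <= (bprime b)%:R / 2)
  (I_incongruent : forall i i' : int, i \in I -> i' \in I -> i <> i' ->
     (i <> i' %[mod (bprime b)%:Z])%Z) :
  (* points *)
  (forall i j : int, i \in I ->
     let x := x0 m a b + i + j * (bprime b)%:Z in
     cong_mod m ((x ^+ 2)%:~R) (parabola m a b i).[j%:~R])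
  /\
  exists jv : int -> rat,
    (* jv i is the vertex, i.e. the unique critical point, of the parabola *)
    (forall i : int, i \in I ->
       forall t : rat, ((parabola m a b i)^`()).[t] = 0 <-> t = jv i)
    /\
    (* abscissas *)
    (forall i : int, i \in I ->
       (x0 m a b)%:~R + i%:~R + jv i * (bprime b)%:R
         = a%:~R / b%:R * m%:R :> rat)
    /\
    (* ordinates *)
    (let yv := fun i : int => (parabola m a b i).[jv i] in
     let gap : rat := m%:R / (bprime b)%:R in
     (forall i i' : int, i \in I -> i' \in I -> i <> i' ->
        ~ cong_mod m (yv i) (yv i'))
     /\
     (exists y : rat,
        (forall i : int, i \in I ->
           exists k : nat,
             (k < bprime b)%N /\ cong_mod m (yv i) (y + k%:R * gap))
        /\
        (forall k : nat, (k < bprime b)%N ->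
           exists i : int,
             i \in I /\ cong_mod m (yv i) (y + k%:R * gap)))
     /\
     (* from each ordinate, the next one modulo m is exactly one gap away *)
     (forall i : int, i \in I ->
        (exists i' : int, i' \in I /\ cong_mod m (yv i') (yv i + gap))
        /\
        (forall (i' : int) (t : rat), i' \in I -> 0 < t -> t < gap ->
           ~ cong_mod m (yv i') (yv i + t)))).
Proof.
have B_gt0 := bprime_gt0 b_gt0.
have m0 : m%:R != 0 :> rat by rewrite pnatr_eq0 -lt0n.
have B0 : (bprime b)%:R != 0 :> rat by rewrite pnatr_eq0 -lt0n.
split=> [i j _ x|].
  rewrite /cong_mod parabola_square // /x.
  set q := (_ %/ _)%Z; set u := slope a b.
  rewrite rmorphXn !rmorphD /= intrM -[(bprime b)%:Z%:~R]/((bprime b)%:R : rat).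
  set s := _ ^+ 2.
  (* The integrality of [j] enters here: the term [u * m * j] is a multiple of [m]. *)
  have -> : (s - (s - u%:~R * m%:R * j%:~R - m%:R * q%:~R)) / m%:R
            = (u * j + q)%:~R by rewrite rmorphD /= intrM; field.
  exact: intr_int.
exists (fun i => (a%:~R / b%:R * m%:R - (x0 m a b)%:~R - i%:~R) / (bprime b)%:R).
split; first by move=> i _ t; exact: parabola_deriv_eq0.
split; first by move=> i _; rewrite divfK //; ring.
move=> yv gap.
have [y [q yvE]] : exists y, exists q : int -> int, forall i,
    yv i = y + (slope a b * i)%:~R * gap - m%:R * (q i)%:~R.
  (* Unification with [vertex_ordinate] sets [y] to its first two terms, which are free of [i]. *)
  by eexists; exists (fun i => ((x0 m a b + i) ^+ 2 %/ m%:Z)%Z) => i;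
    exact: vertex_ordinate.
have cop := slope_coprime coprime_ab.
have onto k := scaled_residue_system k B_gt0 cop card_I I_incongruent.
have cong_y i k : cong_mod m (yv i) (y + k%:~R * gap)
    <-> ((bprime b)%:Z %| slope a b * i - k)%Z.
  apply: (cong_mod_gap (q := q i)) => //.
  by rewrite yvE rmorphB /= -/gap; ring.
have cong_yv i' i k : cong_mod m (yv i') (yv i + k%:~R * gap)
    <-> ((bprime b)%:Z %| slope a b * i' - (slope a b * i + k))%Z.
  apply: (cong_mod_gap (q := q i' - q i)) => //.
  by rewrite !yvE !rmorphB !rmorphD /= -/gap; ring.
split.
  move=> i i' iI i'I ne.
  (* A shift by zero gaps, so that [cong_yv] applies. *)
  have -> : yv i' = yv i' + 0%:~R * gap by rewrite mul0r addr0.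
  rewrite cong_yv addr0 -mulrBr Gauss_dvdzr; last by rewrite coprimez_sym.
  by rewrite -eqz_mod_dvd => /eqP; exact: I_incongruent.
split.
  exists y; split=> [i _ | k _].
    have Bz : (bprime b)%:Z != 0 by lia.
    have ge0 := modz_ge0 (slope a b * i) Bz.
    (* The position of the ordinate above [y], counted in gaps, is the residue of [u * i] modulo
       [b']. *)
    exists `|(slope a b * i %% bprime b)%Z|%N; split.
      by have := ltz_pmod (slope a b * i) (_ : 0 < (bprime b)%:Z); lia.
    by rewrite pmulrn gez0_abs // cong_y -eqz_mod_dvd modz_mod.
  by have [i iI ?] := onto k; exists i; split=> //; rewrite pmulrn cong_y.
move=> i iI; split=> [|i' t i'I t_gt0 t_lt].
  have [i' i'I d] := onto (slope a b * i + 1); exists i'; split=> //.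
  by rewrite -[gap]mul1r -[1]/(1%:~R : rat) cong_yv.
have gap_gt0 : 0 < gap by rewrite divr_gt0 ?ltr0n.
case/intrP=> k; rewrite !yvE => E.
(* Solving the congruence for [t], with [m = b' * gap], makes [t] exactly [n] gaps. Then
   [0 < t < gap] would put the integer [n] strictly between 0 and 1. *)
pose n := slope a b * (i' - i) + (bprime b)%:Z * (q i - q i' - k).
have tE : t = n%:~R * gap.
  have {}E := canRL (divfK m0) E.
  have mE : m%:R = (bprime b)%:R * gap by rewrite mulrC divfK.
  rewrite /n rmorphD /= !intrM !rmorphB /=.
  move: E; rewrite mE !intrM -[(bprime b)%:Z%:~R]/((bprime b)%:R : rat).
  by move=> E; apply/eqP; rewrite -subr_eq0 -oppr_eq0; apply/eqP; lra.
move: t_gt0 t_lt; rewrite tE pmulr_lgt0 // gtr_pMl // ltr0z ltrz1; lia.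
Qed.
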